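(* Let $K$ be any field, let $p\ge 0$ be an integer and $m=2p+1$. Let $e_1,\dots,e_m$ be the standard basis of $K^m$, and for $1\le i\le m$ let $L_i:\bigwedge^pK^m\to\bigwedge^{p+1}K^m$ be the linear map $L_i(w)=e_i\wedge w$. For $1\le r\le 2p+1$, let $S_r$ be the $(p+1)\times(p+1)$ matrix over $K$ with entries $S_r(j,k)=1$ if $k-j=p+1-r$ and $S_r(j,k)=0$ otherwise. Then the linear map $$L:=L_1\otimes S_1+L_2\otimes S_2+\cdots+L_{2p+1}\otimes S_{2p+1}:\ \Big(\bigwedge^pK^m\Big)\otimes K^{p+1}\longrightarrow\Big(\bigwedge^{p+1}K^m\Big)\otimes K^{p+1}$$ is invertible.
   Context: A $(p+1)\times(p+1)$ matrix is viewed as a linear endomorphism of $K^{p+1}$ via the standard basis. *)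

(* Defs.v *)
From HB Require Import structures.
From mathcomp Require Import all_boot all_order all_algebra.

Set Implicit Arguments.
Unset Strict Implicit.
Unset Printing Implicit Defensive.

Import GRing.Theory.
Local Open Scope ring_scope.

Definition basis_vec (K : fieldType) (m : nat) (i : 'I_m) : 'cV[K]_m :=
  delta_mx i ord0.

Definition ksubset (m k : nat) := {A : {set 'I_m} | #|A| == k}.

(* The k-th exterior power of K^m, in coordinates on the basis                *)
(* e_A = e_(a1) /\ ... /\ e_(ak), A = {a1 < ... < ak}; see extprod and        *)
(* extpow_universal for v_1 /\ ... /\ v_k and the universal property.         *)
Definition extpow (K : fieldType) (m k : nat) := {ffun ksubset m k -> K^o}.

Section Wedge.
Variables (K : fieldType) (m k : nat).
Implicit Types (x : 'cV[K]_m) (w : extpow K m k).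

(* The sign comes from sorting: e_i /\ e_A = (-1)^s e_(i |: A) for i \notin A *)
(* with s the number of elements of A below i; e_i /\ e_A = 0 for i \in A.    *)
Definition wedge x w : extpow K m k.+1 :=
  [ffun B : ksubset m k.+1 => \sum_(i < m)
     \sum_(A : ksubset m k | (i \notin val A) && (val B == i |: val A))
        (-1) ^+ #|[set j in val A | (j < i)%N]| * x i ord0 * w A].

Lemma wedge_linear x : linear (wedge x).
Proof.
move=> a u v; apply/ffunP=> B; rewrite !ffunE /= scaler_sumr -big_split /=.
apply: eq_bigr => i _; rewrite scaler_sumr -big_split /=.
apply: eq_bigr => A _; rewrite !ffunE mulrDr /GRing.scale /=.
by congr (_ + _); rewrite mulrCA.
Qed.

HB.instance Definition _ x := GRing.isLinear.Build K (extpow K m k)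
  (extpow K m k.+1) _ (wedge x) (wedge_linear x).

Lemma wedge_linearl w : linear (wedge ^~ w).
Proof.
move=> a u v; apply/ffunP=> B; rewrite !ffunE /= scaler_sumr -big_split /=.
apply: eq_bigr => i _; rewrite scaler_sumr -big_split /=.
apply: eq_bigr => A _; rewrite !mxE mulrDr mulrDl /GRing.scale /=.
by congr (_ + _); rewrite mulrCA !mulrA.
Qed.

End Wedge.

Definition wedge_basis (K : fieldType) (m k : nat) (i : 'I_m) :
  'Hom(extpow K m k, extpow K m k.+1) := linfun (wedge (basis_vec K i)).

Section Universal.
Variables (K : fieldType) (m : nat).

Fixpoint extprod (k : nat) : ('I_k -> 'cV[K]_m) -> extpow K m k :=
  match k with
  | 0 => fun _ => [ffun=> 1]
  | k'.+1 => fun v => wedge (v ord0) (extprod (fun i => v (lift ord0 i)))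
  end.

Definition upd (T : Type) (k : nat) (v : {ffun 'I_k -> T}) i x :=
  [ffun j => if j == i then x else v j].

Definition multilinear (V W : lmodType K) k (f : {ffun 'I_k -> V} -> W) :=
  forall i (v : {ffun 'I_k -> V}), linear (fun x => f (upd v i x)).

Definition alternating (V W : lmodType K) k (f : {ffun 'I_k -> V} -> W) :=
  forall (v : {ffun 'I_k -> V}) i j, i != j -> v i = v j -> f v = 0.

Lemma eq_extprod k (v v' : 'I_k -> 'cV[K]_m) : v =1 v' -> extprod v = extprod v'.
Proof.
elim: k v v' => [|k IH] v v' e //=.
by rewrite e; congr (wedge _ _); apply: IH => i; rewrite e.
Qed.

Definition ext_basis k (A : ksubset m k) : extpow K m k :=
  [ffun B => (B == A)%:R].

Lemma ext_basis_sum k (w : extpow K m k) : w = \sum_A w A *: ext_basis A.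
Proof.
apply/ffunP=> B; rewrite sum_ffunE (bigD1 B) //= big1 => [|A nAB].
  by rewrite !ffunE eqxx addr0 /GRing.scale /= mulr1.
by rewrite !ffunE eq_sym (negPf nAB) scaler0.
Qed.

Lemma wedgeDl k a (x y : 'cV[K]_m) (w : extpow K m k) :
  wedge (a *: x + y) w = a *: wedge x w + wedge y w.
Proof. exact: wedge_linearl. Qed.

Lemma wedge_suml (I : Type) (r : seq I) k (x : I -> 'cV[K]_m)
    (c : I -> K) (w : extpow K m k) :
  wedge (\sum_(i <- r) c i *: x i) w = \sum_(i <- r) c i *: wedge (x i) w.
Proof.
pose wl0 (y : 'cV[K]_m) := wedge y w.
pose wl : {linear 'cV[K]_m -> extpow K m k.+1} :=
  HB.pack wl0 (GRing.isLinear.Build _ _ _ _ _ (wedge_linearl w)).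
rewrite -[LHS]/(wl _) linear_sum; apply: eq_bigr => i _.
by rewrite linearZ.
Qed.

Lemma col_basis (x : 'cV[K]_m) : x = \sum_i x i ord0 *: basis_vec K i.
Proof.
apply/matrixP=> i j; rewrite ord1 summxE (bigD1 i) //= big1 => [|l nli].
  by rewrite !mxE !eqxx addr0 mulr1.
by rewrite !mxE eq_sym (negPf nli) mulr0.
Qed.

Definition nbelow (i : 'I_m) (A : {set 'I_m}) := #|[set j in A | (j < i)%N]|.

Lemma wedge_ext_basisE k i (A : ksubset m k) (B : ksubset m k.+1) :
  wedge (basis_vec K i) (ext_basis A) B =
    if (i \notin val A) && (val B == i |: val A) then (-1) ^+ nbelow i (val A)
    else 0.
Proof.
rewrite ffunE (bigD1 i) //= [X in _ + X]big1 ?addr0 => [|j nji]; last first.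
  by rewrite big1 // => C _; rewrite mxE (negPf nji) mulr0 mul0r.
case: ifP => [H | nH].
  rewrite (bigD1 A) //= big1 ?addr0 => [|C /andP[_ nCA]].
    by rewrite mxE ffunE !eqxx !mulr1.
  by rewrite ffunE (negPf nCA) mulr0.
rewrite big1 // => C H; rewrite ffunE; case: eqP => [E|]; rewrite ?mulr0 //.
by rewrite -E H in nH.
Qed.

Lemma wedge_ext_basis k i (A : ksubset m k) (B : ksubset m k.+1) :
  i \notin val A -> val B = i |: val A ->
  wedge (basis_vec K i) (ext_basis A) = (-1) ^+ nbelow i (val A) *: ext_basis B.
Proof.
move=> iA EB; apply/ffunP=> C; rewrite wedge_ext_basisE iA !ffunE /= -EB.
by rewrite val_eqE; case: eqP => _; rewrite ?scaler0 // /GRing.scale /= mulr1.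
Qed.

Lemma wedge_ext_basis0 k i (A : ksubset m k) :
  i \in val A -> wedge (basis_vec K i) (ext_basis A) = 0.
Proof. by move=> iA; apply/ffunP=> C; rewrite wedge_ext_basisE iA ffunE. Qed.

Lemma adjoinP k i (A : ksubset m k) : i \notin val A ->
  exists B : ksubset m k.+1, val B = i |: val A.
Proof.
move=> iA; have H : #|i |: val A| == k.+1 by rewrite cardsU1 iA (eqP (valP A)).
by exists (Sub (i |: val A) H).
Qed.

Lemma nbelowU i j (A : {set 'I_m}) : j \notin A ->
  nbelow i (j |: A) = ((j < i) + nbelow i A)%N.
Proof.
move=> jA; rewrite /nbelow; case: (ltnP j i) => [ji | ij].
  rewrite (_ : [set _ in _ | _] = j |: [set l in A | (l < i)%N]).
    by rewrite cardsU1 inE (negPf jA).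
  by apply/setP=> l; rewrite !inE; case: eqP => // ->; rewrite ji.
apply: eq_card => l; rewrite !inE; case: eqP => // ->.
by rewrite (negPf jA) ltnNge ij.
Qed.

Lemma wedge_anti_basis k i j (A : ksubset m k) :
  wedge (basis_vec K i) (wedge (basis_vec K j) (ext_basis A)) +
  wedge (basis_vec K j) (wedge (basis_vec K i) (ext_basis A)) = 0.
Proof.
have [jA|jA] := boolP (j \in val A).
  rewrite (wedge_ext_basis0 jA) linear0 add0r.
  have [iA|iA] := boolP (i \in val A); first by rewrite wedge_ext_basis0 // linear0.
  have [B EB] := adjoinP iA; rewrite (wedge_ext_basis iA EB) linearZ /=.
  by rewrite wedge_ext_basis0 ?scaler0 // EB !inE jA orbT.
have [B EB] := adjoinP jA; rewrite (wedge_ext_basis jA EB) linearZ /=.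
have [iA|iA] := boolP (i \in val A).
  rewrite (wedge_ext_basis0 iA) linear0 addr0.
  by rewrite wedge_ext_basis0 ?scaler0 // EB !inE iA orbT.
have [C EC] := adjoinP iA; rewrite (wedge_ext_basis iA EC) linearZ /=.
have [eij|nij] := eqVneq i j.
  by rewrite !wedge_ext_basis0 ?scaler0 ?addr0 // ?EB ?EC !inE eij eqxx.
have iB : i \notin val B by rewrite EB !inE negb_or nij.
have jC : j \notin val C by rewrite EC !inE negb_or eq_sym nij.
have [D ED] := adjoinP iB.
have ED' : val D = j |: val C by rewrite ED EB EC setUCA.
rewrite (wedge_ext_basis iB ED) (wedge_ext_basis jC ED') EB EC !nbelowU //.
rewrite !scalerA -scalerDl !exprD.
set a := (-1) ^+ nbelow i _; set b := (-1) ^+ nbelow j _.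
suff -> : b * ((-1) ^+ (j < i)%N * a) + a * ((-1) ^+ (i < j)%N * b) = 0.
  by rewrite scale0r.
have [ij|ji] := ltnP i j.
  by rewrite ltnNge (ltnW ij) expr0 expr1 mul1r mulN1r mulrN mulrC subrr.
have -> : (j < i)%N by rewrite ltn_neqAle ji andbT eq_sym.
by rewrite expr0 expr1 mul1r mulN1r mulrN mulrC addNr.
Qed.

Lemma wedge_anti k x y (w : extpow K m k) :
  wedge x (wedge y w) + wedge y (wedge x w) = 0.
Proof.
rewrite [w]ext_basis_sum !linear_sum -big_split big1 // => A _ /=.
rewrite !linearZ -scalerDr /=.
suff -> : wedge x (wedge y (ext_basis A)) + wedge y (wedge x (ext_basis A)) = 0.
  by rewrite scaler0.
rewrite (col_basis x) !wedge_suml linear_sum.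
rewrite -big_split big1 // => i _ /=; rewrite linearZ -scalerDr /=.
rewrite (col_basis y) !wedge_suml linear_sum.
rewrite -big_split big1 ?scaler0 // => j _ /=.
by rewrite linearZ -scalerDr /= wedge_anti_basis scaler0.
Qed.

Lemma wedge_sq k x (w : extpow K m k) : wedge x (wedge x w) = 0.
Proof.
have Hb i : wedge (basis_vec K i) (wedge (basis_vec K i) w) = 0.
  rewrite [w]ext_basis_sum !linear_sum big1 // => A _ /=; rewrite !linearZ /=.
  have [iA|iA] := boolP (i \in val A).
    by rewrite (wedge_ext_basis0 iA) linear0 scaler0.
  have [B EB] := adjoinP iA; rewrite (wedge_ext_basis iA EB) linearZ /=.
  by rewrite wedge_ext_basis0 ?scaler0 // EB !inE eqxx.
rewrite (col_basis x); elim/big_rec: _ => [|i y _ IH].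
  have := wedge_suml [::] (fun _ : 'I_m => x) (fun=> 0) w.
  by rewrite !big_nil => ->; rewrite linear0.
rewrite !wedgeDl !linearP /= Hb !scaler0 add0r IH addr0.
have := wedge_anti (basis_vec K i) y w.
by rewrite -scalerDr => ->; rewrite scaler0.
Qed.

Lemma extprod_multilinear k :
  multilinear (fun v : {ffun 'I_k -> 'cV[K]_m} => extprod v).
Proof.
elim: k => [|k IH] i v a x y; first by case: i.
rewrite /=; have [j ->|->] := unliftP ord0 i; last first.
  have E z : extprod (fun l => upd v ord0 z (lift ord0 l)) =
             extprod (fun l => v (lift ord0 l)).
    by apply: eq_extprod => l; rewrite ffunE eq_sym (negPf (neq_lift _ _)).
  by rewrite !E !ffunE !eqxx wedgeDl.
have E z : extprod (fun l => upd v (lift ord0 j) z (lift ord0 l)) =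
           extprod (upd [ffun l => v (lift ord0 l)] j z).
  by apply: eq_extprod => l; rewrite !ffunE (inj_eq lift_inj).
have E0 z : upd v (lift ord0 j) z ord0 = v ord0.
  by rewrite ffunE (negPf (neq_lift _ _)).
by rewrite !E !E0 IH linearP.
Qed.

Lemma wedge_extprod0 k (v : 'I_k -> 'cV[K]_m) j : wedge (v j) (extprod v) = 0.
Proof.
elim: k v j => [|k IH] v j; first by case: j.
have [l ->|->] := unliftP ord0 j; last by rewrite /= wedge_sq.
apply: (addIr (wedge (v ord0) (wedge (v (lift ord0 l))
                 (extprod (fun i => v (lift ord0 i)))))).
by rewrite wedge_anti (IH (fun i => v (lift ord0 i))) linear0 addr0.
Qed.

Lemma extprod_alternating k :
  alternating (fun v : {ffun 'I_k -> 'cV[K]_m} => extprod v).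
Proof.
elim: k => [|k IH] v i j; first by case: i.
have [i' ->|->] := unliftP ord0 i; have [j' ->|->] := unliftP ord0 j => /=.
- rewrite (inj_eq lift_inj) => nij e.
  have E : extprod (fun l => v (lift ord0 l)) =
           extprod [ffun l => v (lift ord0 l)].
    by apply: eq_extprod => l; rewrite ffunE.
  by rewrite E (IH _ _ _ nij) ?linear0 // !ffunE.
- by move=> _ <-; rewrite (wedge_extprod0 (fun l => v (lift ord0 l))).
- by move=> _ ->; rewrite (wedge_extprod0 (fun l => v (lift ord0 l))).
- by move=> /eqP.
Qed.

Lemma ext_basis_extprod k (A : ksubset m k) :
  exists c (v : {ffun 'I_k -> 'cV[K]_m}), ext_basis A = c *: extprod v.
Proof.
elim: k A => [|k IH] A.
  exists 1, [ffun=> 0]; apply/ffunP=> B; rewrite !ffunE /= scale1r.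
  suff -> : B = A by rewrite eqxx.
  apply: val_inj; have := valP A; have := valP B.
  by rewrite !cards_eq0 => /eqP-> /eqP->.
have [a aA] : exists a, a \in val A.
  by apply/set0Pn; rewrite -card_gt0 (eqP (valP A)).
have H : #|val A :\ a| == k.
  by have := valP A; rewrite /= (cardsD1 a) aA add1n eqSS.
pose A' : ksubset m k := Sub (val A :\ a) H.
have aA' : a \notin val A' by rewrite !inE eqxx.
have EA : val A = a |: val A' by rewrite /= setD1K.
have [c [v E]] := IH A'.
exists ((-1) ^+ nbelow a (val A') * c),
  [ffun i => if unlift ord0 i is Some j then v j else basis_vec K a].
rewrite /= ffunE unlift_none.
rewrite (eq_extprod (v' := v)) => [|i]; last by rewrite ffunE liftK.
rewrite -scalerA.
have -> : c *: wedge (basis_vec K a) (extprod v) =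
          (-1) ^+ nbelow a (val A') *: ext_basis A.
  by rewrite -(wedge_ext_basis aA' EA) E linearZ.
rewrite scalerA.
by rewrite -exprD addnn -mul2n exprM sqrrN !expr1n scale1r.
Qed.

Definition fcons (T : Type) k (x : T) (v : {ffun 'I_k -> T}) :
    {ffun 'I_k.+1 -> T} :=
  [ffun i => if unlift ord0 i is Some j then v j else x].

Lemma wedge_basis_extprod k i (v : {ffun 'I_k -> 'cV[K]_m}) :
  wedge_basis K k i (extprod v) = extprod (fcons (basis_vec K i) v).
Proof.
rewrite lfunE /= ffunE unlift_none; congr (wedge _ _).
by apply: eq_extprod => j; rewrite ffunE liftK.
Qed.

Section Alt.
Variables (V W : lmodType K).
Implicit Types (s : seq V).

Definition seqfun k (s : seq V) : {ffun 'I_k -> V} := [ffun j => nth 0 s (val j)].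

Lemma alt_swap k (f : {ffun 'I_k -> V} -> W) : multilinear f -> alternating f ->
  forall s1 s2 x y, size (s1 ++ x :: y :: s2) = k ->
  f (seqfun k (s1 ++ x :: y :: s2)) = - f (seqfun k (s1 ++ y :: x :: s2)).
Proof.
move=> fm fa s1 s2 x y; rewrite size_cat /= => sz.
have ik : (size s1 < k)%N by rewrite -sz -addSnnS leq_addr.
have jk : ((size s1).+1 < k)%N by rewrite -sz !addnS !ltnS leq_addr.
pose i := Ordinal ik; pose j := Ordinal jk.
have nij : i != j by rewrite -val_eqE /= ltn_eqF.
pose v := seqfun k (s1 ++ x :: y :: s2).
pose G a b := f (upd (upd v i a) j b).
have GD1 a a' b : G (a + a') b = G a b + G a' b.
  have C c : upd (upd v i c) j b = upd (upd v j b) i c.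
    apply/ffunP=> l; rewrite !ffunE; case: eqP => // ->.
    by rewrite eq_sym (negPf nij).
  by rewrite /G !C -[a]scale1r fm !scale1r.
have GD2 a b b' : G a (b + b') = G a b + G a b'.
  by rewrite /G -[b]scale1r fm !scale1r.
have G0 a : G a a = 0.
  by apply: (fa _ i j nij); rewrite !ffunE (negPf nij) !eqxx.
have E a b : seqfun k (s1 ++ a :: b :: s2) = upd (upd v i a) j b.
  apply/ffunP=> l; rewrite !ffunE -!val_eqE /= !nth_cat.
  case: (ltngtP (val l) (size s1)) => [h|h|->]; last first.
  - by rewrite subnn /= ltn_eqF.
  - case: eqP => [->|]; first by rewrite subSn // subnn.
    move=> ne; have : (1 < val l - size s1)%N.
      by rewrite ltn_subRL addn1 ltn_neqAle h andbT eq_sym; apply/eqP.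
    by case: (_ - _)%N => [|[|?]].
  - by rewrite ltn_eqF // (ltn_trans h).
rewrite !E -/(G x y) -/(G y x); apply/eqP; rewrite -addr_eq0.
by have := G0 (x + y); rewrite GD1 !GD2 !G0 add0r addr0 => ->.
Qed.

Lemma alt_insert k (f : {ffun 'I_k -> V} -> W) : multilinear f -> alternating f ->
  forall s1 s2 x, size (x :: s1 ++ s2) = k ->
  f (seqfun k (x :: s1 ++ s2)) = (-1) ^+ size s1 *: f (seqfun k (s1 ++ x :: s2)).
Proof.
move=> fm fa s1 s2 x.
suff H : forall s0, size (s0 ++ x :: s1 ++ s2) = k ->
    f (seqfun k (s0 ++ x :: s1 ++ s2)) =
    (-1) ^+ size s1 *: f (seqfun k (s0 ++ s1 ++ x :: s2)) by exact: (H [::]).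
elim: s1 => [|y s1 IH] s0 sz; first by rewrite scale1r.
rewrite /= (alt_swap fm fa) // -cat_rcons IH; last first.
  by move: sz; rewrite !size_cat size_rcons /= !size_cat addSnnS.
by rewrite cat_rcons exprS mulN1r scaleNr.
Qed.

Lemma alt_repeat k (f : {ffun 'I_k -> V} -> W) : alternating f ->
  forall s x, size (x :: s) = k -> x \in s -> f (seqfun k (x :: s)) = 0.
Proof.
move=> fa s x; case: k f fa => // k f fa /= [sz] xs.
have lt : ((index x s).+1 < k.+1)%N by rewrite ltnS -sz index_mem.
by apply: (fa _ ord0 (Ordinal lt)) => //; rewrite !ffunE /= nth_index.
Qed.

End Alt.

Lemma enum_adjoin (i : 'I_m) (A : {set 'I_m}) : i \notin A ->
  exists s1 s2, [/\ enum A = s1 ++ s2, enum (i |: A) = s1 ++ i :: s2 &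
                    size s1 = nbelow i A].
Proof.
move=> iA; have so : sorted ltn (map val (enum 'I_m)).
  by rewrite val_enum_ord iota_ltn_sorted.
have /splitPr Ei : i \in enum 'I_m by rewrite mem_enum.
case EE : _ / Ei => [t1 t2]; move: (so); rewrite EE map_cat /=.
rewrite sorted_pairwise; last exact: ltn_trans.
rewrite pairwise_cat /= => /and3P[/allrelP H1 _ /andP[/allP H2 _]].
have lt1 j : j \in t1 -> (j < i)%N.
  by move=> jt; apply: H1; rewrite ?map_f // inE eqxx.
have lt2 j : j \in t2 -> (i < j)%N by move=> jt; apply: H2; rewrite map_f.
have enumE (C : {set 'I_m}) : enum C = [seq j <- t1 ++ i :: t2 | j \in C].
  by rewrite -EE enumT.
exists [seq j <- t1 | j \in A], [seq j <- t2 | j \in A]; split.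
- by rewrite enumE filter_cat /= (negPf iA).
- rewrite enumE filter_cat /= !inE eqxx.
  congr (_ ++ _ :: _); apply: eq_in_filter => j jt; rewrite !inE.
    by rewrite -val_eqE /= ltn_eqF // lt1.
  by rewrite -val_eqE /= gtn_eqF // lt2.
rewrite /nbelow cardE enumE filter_cat /= !inE (negPf iA) /=.
rewrite [X in _ ++ X](eq_in_filter (a2 := pred0)) ?filter_pred0 ?cats0 => [|j jt].
  by congr size; apply: eq_in_filter => j jt; rewrite !inE lt1 // andbT.
by rewrite !inE ltnNge (ltnW (lt2 j jt)) andbF.
Qed.

Definition set_vecs k (A : {set 'I_m}) : {ffun 'I_k -> 'cV[K]_m} :=
  seqfun k [seq basis_vec K i | i <- enum A].

Definition ext_lift (W : lmodType K) k (f : {ffun 'I_k -> 'cV[K]_m} -> W)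
  (w : extpow K m k) : W := \sum_A w A *: f (set_vecs k (val A)).

Lemma ext_lift_linear (W : lmodType K) k (f : {ffun 'I_k -> 'cV[K]_m} -> W) :
  linear (ext_lift f).
Proof.
move=> a u v; rewrite /ext_lift scaler_sumr -big_split.
by apply: eq_bigr => A _; rewrite !ffunE scalerDl scalerA.
Qed.

HB.instance Definition _ (W : lmodType K) k (f : {ffun 'I_k -> 'cV[K]_m} -> W) :=
  GRing.isLinear.Build K (extpow K m k) W _ (ext_lift f) (ext_lift_linear f).

Lemma ext_lift_basis (W : lmodType K) k (f : {ffun 'I_k -> 'cV[K]_m} -> W) A :
  ext_lift f (ext_basis A) = f (set_vecs k (val A)).
Proof.
rewrite /ext_lift (bigD1 A) //= big1 => [|B nBA].
  by rewrite ffunE eqxx scale1r addr0.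
by rewrite ffunE (negPf nBA) scale0r.
Qed.

Lemma ext_lift_extprod (W : lmodType K) k (f : {ffun 'I_k -> 'cV[K]_m} -> W) :
  multilinear f -> alternating f ->
  forall v : {ffun 'I_k -> 'cV[K]_m}, ext_lift f (extprod v) = f v.
Proof.
elim: k f => [|k IH] f fm fa v.
  rewrite /ext_lift (bigD1 (Sub set0 (introT eqP (cards0 _)))) //= big1 ?addr0.
    by rewrite ffunE scale1r; congr f; apply/ffunP=> -[].
  move=> A; rewrite -val_eqE /=; have := valP A.
  by rewrite /= cards_eq0 => /eqP->; rewrite eqxx.
pose fx x (v : {ffun 'I_k -> 'cV[K]_m}) := f (fcons x v).
have consU x u i z : fcons x (upd u i z) = upd (fcons x u) (lift ord0 i) z.
  apply/ffunP=> j; rewrite !ffunE; case: (unliftP ord0 j) => [l ->|->].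
    by rewrite (inj_eq lift_inj) ffunE.
  by rewrite (negPf (neq_lift _ _)).
have fxm x : multilinear (fx x) by move=> i u a y z; rewrite /fx !consU fm.
have fxa x : alternating (fx x).
  move=> u i j nij e; apply: (fa _ (lift ord0 i) (lift ord0 j)).
    by rewrite (inj_eq lift_inj).
  by rewrite !ffunE !liftK.
have consl (u : {ffun 'I_k -> 'cV[K]_m}) : linear (fun x => fx x u).
  have E x : fcons x u = upd (fcons 0 u) ord0 x.
    apply/ffunP=> j; rewrite !ffunE; case: (unliftP ord0 j) => [l ->|->].
      by rewrite eq_sym (negPf (neq_lift _ _)).
    by rewrite eqxx.
  by move=> a x y; rewrite /fx (E (_ + _)) (E x) (E y) fm.
suff H x (w : extpow K m k) : ext_lift f (wedge x w) = ext_lift (fx x) w.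
  rewrite /= H (eq_extprod (v' := [ffun l => v (lift ord0 l)])) => [|l].
    rewrite IH //; congr f; apply/ffunP=> j; rewrite ffunE.
    by case: (unliftP ord0 j) => [l ->|->]; rewrite ?ffunE.
  by rewrite ffunE.
have Lx w' : linear (fun x => ext_lift (fx x) w').
  move=> a y z; rewrite /ext_lift scaler_sumr -big_split; apply: eq_bigr => A _.
  by rewrite consl scalerDr !scalerA mulrC.
pose LX w' : {linear 'cV[K]_m -> W} :=
  HB.pack (fun x => ext_lift (fx x) w') (GRing.isLinear.Build _ _ _ _ _ (Lx w')).
have -> : ext_lift (fx x) w = LX w x by [].
rewrite [in LHS](col_basis x) wedge_suml [in RHS](col_basis x) !linear_sum.
apply: eq_bigr => i _; rewrite !linearZ; congr (_ *: _).
rewrite /= [w]ext_basis_sum !linear_sum; apply: eq_bigr => A _.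
rewrite /= !linearZ; congr (_ *: _); rewrite /= ext_lift_basis.
have cE : fcons (basis_vec K i) (set_vecs k (val A)) =
    seqfun k.+1 [seq basis_vec K j | j <- i :: enum (val A)].
  apply/ffunP=> j; rewrite !ffunE.
  by case: (unliftP ord0 j) => [l ->|->]; rewrite ?ffunE.
have sz : size (enum (val A)) = k by rewrite -cardE (eqP (valP A)).
rewrite /fx cE /=; have [iA|iA] := boolP (i \in val A).
  rewrite (wedge_ext_basis0 iA) linear0 alt_repeat ?size_map ?sz //=.
    by rewrite size_map sz.
  by rewrite map_f // mem_enum.
have [B EB] := adjoinP iA.
rewrite (wedge_ext_basis iA EB) linearZ /= ext_lift_basis /set_vecs EB.
have [s1 [s2 [E1 -> <-]]] := enum_adjoin iA.
rewrite E1 !map_cat alt_insert ?size_map //.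
by rewrite /= -map_cat size_map -E1 sz.
Qed.

Lemma extpow_universal k (W : lmodType K) (f : {ffun 'I_k -> 'cV[K]_m} -> W) :
    multilinear f -> alternating f ->
  exists g : {linear extpow K m k -> W},
    (forall v : {ffun 'I_k -> 'cV[K]_m}, g (extprod v) = f v) /\
    (forall h : {linear extpow K m k -> W},
       (forall v : {ffun 'I_k -> 'cV[K]_m}, h (extprod v) = f v) -> h =1 g).
Proof.
move=> fm fa; exists (ext_lift f); split=> [v|h hE w].
  exact: ext_lift_extprod.
rewrite [w]ext_basis_sum !linear_sum; apply: eq_bigr => A _; rewrite !linearZ.
have [c [v ->]] := ext_basis_extprod A.
by rewrite !linearZ hE /= ext_lift_extprod.
Qed.

End Universal.

Section Tensor.
Variable K : fieldType.

Definition dual (V : vectType K) := 'Hom(V, K^o).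

(* For finite-dimensional U and V, the tensor product of U and V is           *)
(* Hom(V^*, U), where tens u v maps phi to phi v *: u; see tensor_universal.  *)
Definition tensor (U V : vectType K) := 'Hom(dual V, U).

Definition tens_fun (U V : vectType K) (u : U) (v : V) (phi : dual V) : U :=
  phi v *: u.

Lemma tens_fun_linear (U V : vectType K) (u : U) (v : V) :
  linear (tens_fun u v).
Proof. by move=> a f g; rewrite /tens_fun !lfunE /= scalerDl !lfunE scalerA. Qed.

HB.instance Definition _ (U V : vectType K) (u : U) (v : V) :=
  GRing.isLinear.Build K (dual V) U _ (tens_fun u v) (tens_fun_linear u v).

Definition tens (U V : vectType K) (u : U) (v : V) : tensor U V :=
  linfun (tens_fun u v).

Section Map.
Variables (U V U' V' : vectType K) (f : 'Hom(U, U')) (g : 'Hom(V, V')).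

Definition dual_map_fun (phi : dual V') : dual V := (phi \o g)%VF.

Lemma dual_map_linear : linear dual_map_fun.
Proof. by move=> a s t; apply/lfunP=> v; do !rewrite !lfunE /=. Qed.

HB.instance Definition _ :=
  GRing.isLinear.Build K (dual V') (dual V) _ dual_map_fun dual_map_linear.

Definition dual_map : 'Hom(dual V', dual V) := linfun dual_map_fun.

Definition tensor_map_fun (X : tensor U V) : tensor U' V' :=
  (f \o X \o dual_map)%VF.

Lemma tensor_map_linear : linear tensor_map_fun.
Proof.
by move=> a X Y; apply/lfunP=> v; do !rewrite !lfunE /=; rewrite linearP.
Qed.

HB.instance Definition _ :=
  GRing.isLinear.Build K (tensor U V) (tensor U' V') _ tensor_map_fun
    tensor_map_linear.

Definition tensor_map : 'Hom(tensor U V, tensor U' V') := linfun tensor_map_fun.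

Lemma tensor_mapE u v : tensor_map (tens u v) = tens (f u) (g v).
Proof.
rewrite lfunE; apply/lfunP=> phi; do !rewrite !lfunE /=.
by rewrite /tens_fun linearZ; do !rewrite !lfunE /=.
Qed.

End Map.

Lemma tens_bilinear (U V : vectType K) :
  (forall v : V, linear (fun u : U => tens u v)) /\
  (forall u : U, linear (fun v : V => tens u v)).
Proof.
split=> [v|u] a x y; apply/lfunP=> phi; do !rewrite !lfunE /=; rewrite /tens_fun.
  by rewrite scalerDr !scalerA mulrC.
by rewrite linearP scalerDl scalerA.
Qed.

Lemma tensor_universal (U V : vectType K) (W : lmodType K) (b : U -> V -> W) :
    (forall v, linear (b ^~ v)) -> (forall u, linear (b u)) ->
  exists g : {linear tensor U V -> W},
    (forall u v, g (tens u v) = b u v) /\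
    (forall h : {linear tensor U V -> W},
       (forall u v, h (tens u v) = b u v) -> h =1 g).
Proof.
move=> bl br.
pose BL v : {linear U -> W} :=
  HB.pack (b ^~ v) (GRing.isLinear.Build _ _ _ _ _ (bl v)).
pose BR u : {linear V -> W} :=
  HB.pack (b u) (GRing.isLinear.Build _ _ _ _ _ (br u)).
pose e := vbasis {:V}; have eP : basis_of {:V} e by exact: vbasisP.
pose ed k : dual V := linfun (coord e k : V -> K^o).
have edE v : v = \sum_k ed k v *: e`_k.
  rewrite [LHS](coord_basis eP) ?memvf //.
  by apply: eq_bigr => k _; rewrite lfunE.
pose g (X : tensor U V) := \sum_k b (X (ed k)) e`_k.
have gl : linear g.
  move=> a X Y; rewrite /g scaler_sumr -big_split; apply: eq_bigr => k _ /=.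
  by rewrite !lfunE /= !lfunE -[LHS]/(BL _ _) linearP.
pose G : {linear _ -> _} := HB.pack g (GRing.isLinear.Build _ _ _ _ _ gl).
have GE u v : G (tens u v) = b u v.
  rewrite /= /g [in RHS](edE v) -[RHS]/(BR u _) linear_sum.
  apply: eq_bigr => k _; rewrite linearZ lfunE /tens_fun.
  by rewrite -[LHS]/(BL _ _) linearZ.
exists G; split=> // h hE X.
have -> : X = \sum_k tens (X (ed k)) e`_k.
  apply/lfunP=> phi; rewrite sum_lfunE.
  have {1}-> : phi = \sum_(k < \dim {:V}) phi e`_k *: ed k.
    apply/lfunP=> v; rewrite [in LHS](edE v) linear_sum sum_lfunE.
    by apply: eq_bigr => k _; rewrite linearZ scale_lfunE; exact: mulrC.
  rewrite linear_sum; apply: eq_bigr => k _.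
  by rewrite linearZ [in RHS]lfunE.
by rewrite !linear_sum; apply: eq_bigr => k _; rewrite hE GE.
Qed.

End Tensor.

Definition mx_endo (K : fieldType) (n : nat) (A : 'M[K]_n) :
  'End('cV[K]_n) := linfun (mulmx A : 'cV[K]_n -> 'cV[K]_n).

(* Rows and columns are indexed from 0; only the difference k - j matters.    *)
Definition shift_mx (K : fieldType) (p r : nat) : 'M[K]_p.+1 :=
  \matrix_(j, k) (k%:Z - j%:Z == p%:Z + 1 - r%:Z)%:R.

(* Main.v *)
From HB Require Import structures.
Require Import Defs.
From mathcomp Require Import all_boot all_order all_algebra zify.

Set Implicit Arguments.
Unset Strict Implicit.
Unset Printing Implicit Defensive.

Import GRing.Theory.
Local Open Scope ring_scope.

(** An element of the domain is a tuple w_0, ..., w_p in the p-th exterior power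
of K^(2p+1), and with indices from 0 the j-th component of its image is the sum
over k of e_(p+j-k) /\ w_k. Both spaces have dimension (p+1) C(2p+1, p), so it
is enough to show that all w_k vanish when these p+1 components do.

In coordinates there is one unknown for each pair (I, n), where I is a p-subset
of {0, ..., 2p} and n = p-k lies in 0, ..., p, and one equation for each pair
(J, j), where J is a (p+1)-subset. Up to signs, equation (J, j) says that the
unknowns (J \ b, b - j), over the b in J with j <= b <= j + p, sum to zero.
Match the unknown (I, n) with the equation (J, j) in which J = I + a, where a is
the element of rank n in the complement of I, and j is the rank of a in J. Then
a = j + n because an element preceded by j members of J and n non-members is
j + n itself, so that the unknown does occur in its equation with coefficient
1 or -1; and every pair (J, a) with a in J comes from exactly one unknown.

The system is triangular for this matching, which makes the result independent
of the characteristic. Give the pair (J, a) the number whose ternary digit at c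
is 0 for c outside J, 1 for c in J with c <= a, and 2 for c in J with c > a
([marked_weight]). If another unknown (J \ b, b - j) of the equation matched with
(J, a) is itself matched with (J \ b + a', j'), then a' > b when b > a, and
a' < b when b < a. In the first case the leading digit that changes is the one
at a', which goes from 0 to 1; in the second it is the one at a, which goes from
1 to 2. So the weight increases ([marked_weight_step]), and the unknowns vanish
one after the other, starting with those of largest weight ([subset_descent],
[hankel_wedge_inj]). *)

(** * Comparing ternary expansions *)

Section Ternary.
Local Open Scope nat_scope.

Lemma ternary_lt n (d : 'I_n -> nat) :
  (forall c, d c <= 2) -> \sum_c d c * 3 ^ c < 3 ^ n.
Proof.
elim: n d => [|n IH] d d2; first by rewrite big_ord0.
rewrite big_ord_recr expnS /=.
have := IH (fun c => d (widen_ord (leqnSn n) c)) (fun c => d2 _).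
have : d ord_max * 3 ^ n <= 2 * 3 ^ n by rewrite leq_mul2r d2 orbT.
by rewrite /=; lia.
Qed.

(** The comparison is decided by the leading digit at which the expansions differ,
because the digits of the smaller one below it add up to less than one unit at
that position. *)
Lemma ternary_lex n (d d' : 'I_n -> nat) (t : 'I_n) :
  (forall c, d c <= 2) -> (forall c : 'I_n, t < c -> d c = d' c) ->
  d t < d' t -> \sum_c d c * 3 ^ c < \sum_c d' c * 3 ^ c.
Proof.
elim: n d d' t => [|n IH] d d' t d2 dd' lt; first by case: t {dd' lt}.
rewrite !big_ord_recr /=; have [tn | tn] := ltnP t n; last first.
  have et : t = ord_max by apply/val_inj => /=; have := ltn_ord t; lia.
  have := @ternary_lt n (fun c => d (widen_ord (leqnSn n) c)) (fun c => d2 _).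
  have : (d ord_max).+1 * 3 ^ n <= d' ord_max * 3 ^ n.
    by rewrite leq_mul2r -et lt orbT.
  by rewrite mulSn /=; lia.
rewrite (dd' ord_max) // ltn_add2r.
have et : t = widen_ord (leqnSn n) (Ordinal tn) by apply: val_inj.
rewrite et in dd' lt.
apply: (IH (fun c => d (widen_ord _ c)) (fun c => d' (widen_ord _ c))
  (Ordinal tn)) => // c tc.
exact: dd'.
Qed.

End Ternary.

(** * Ranks in a subset and in its complement *)

Section Nbelow.
Local Open Scope nat_scope.
Variable m : nat.
Implicit Types (a b c : 'I_m) (A I J : {set 'I_m}).

Lemma leq_nbelow a b A : a <= b -> nbelow a A <= nbelow b A.
Proof.
move=> ab; apply/subset_leq_card/subsetP => c; rewrite !inE => /andP[-> ca].
exact: leq_trans ca ab.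
Qed.

Lemma ltn_nbelow a b A : a \in A -> a < b -> nbelow a A < nbelow b A.
Proof.
move=> aA ab; apply/proper_card/properP; split; last first.
  by exists a; rewrite !inE aA ?ab ?ltnn.
apply/subsetP => c; rewrite !inE => /andP[-> ca]; exact: ltn_trans ca ab.
Qed.

(** This identity turns the index a - j of an unknown into a rank in the
complement, which is what makes the matching bijective. *)
Lemma nbelowC a A : nbelow a A + nbelow a (~: A) = a.
Proof.
have E : #|[set c : 'I_m | c < a]| = a.
  rewrite -sum1dep_card -(big_ord_widen m (fun=> 1)) ?sum1_card ?card_ord //.
  exact: ltnW.
rewrite -[RHS]E -(cardsID A); congr (_ + _); apply: eq_card => c;
  by rewrite !inE andbC.
Qed.

Lemma nbelowD1 a b A : b \in A -> nbelow a A = (b < a) + nbelow a (A :\ b).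
Proof.
by move=> bA; rewrite -[in LHS](setD1K bA) nbelowU // !inE eqxx.
Qed.

Lemma nbelow_nth A k : k < #|A| -> exists2 a, a \in A & nbelow a A = k.
Proof.
move=> kA; have [c _] : exists c, c \in A.
  by apply/card_gt0P; exact: leq_ltn_trans kA.
have kE : k < size (enum A) by rewrite -cardE.
pose a := nth c (enum A) k.
have aA : a \in A by rewrite -mem_enum mem_nth.
have aN : a \notin A :\ a by rewrite !inE eqxx.
exists a => //; rewrite (nbelowD1 a aA) ltnn.
have [s1 [s2 [_ E <-]]] := enum_adjoin aN.
rewrite setD1K // in E.
have uE : uniq (s1 ++ a :: s2) by rewrite -E enum_uniq.
apply/eqP; rewrite -(nth_uniq c _ _ uE) -?E //; last first.
  by rewrite E size_cat /= addnS ltnS leq_addr.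
by rewrite [in X in X == _]E nth_cat ltnn subnn.
Qed.

(** * The weight of a marked subset *)

(** As a number in base 3 this orders the pairs (J, a), with a in J,
lexicographically from the top position down; the mark a splits J into digits 1
(up to a) and digits 2 (above a). *)
Definition marked_weight J a := \sum_(c < m) (c \in J) * (1 + (a < c)) * 3 ^ c.

Lemma marked_weight_lt J a : marked_weight J a < 3 ^ m.
Proof. by apply: ternary_lt => c; case: (_ \in _); case: (_ < _). Qed.

(** Triangularity: among the unknowns of the equation (J, j), with j the rank of a
in J, each one other than (J \ a, a - j) is matched with a pair of larger
weight. *)
Lemma marked_weight_step J a b a' :
    a \in J -> b \in J -> b != a -> a' \notin J :\ b ->
    nbelow a J <= b -> nbelow a' (~: (J :\ b)) = b - nbelow a J ->
  marked_weight J a < marked_weight (a' |: J :\ b) a'.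
Proof.
move=> aJ bJ nba a'I jb e.
have [ab|ba] := ltnP a b.
  (* In the complement of J \ b, the element b has rank less than b - j, since
     more than j elements of J lie below b (a and those below a); the rank of a'
     is exactly b - j. *)
  have ba' : b < a'.
    rewrite ltnNge; apply/negP => a'b.
    have := leq_nbelow (~: (J :\ b)) a'b; rewrite e.
    have := nbelowC b (J :\ b); have := ltn_nbelow aJ ab.
    by rewrite (nbelowD1 b bJ) ltnn; lia.
  apply: (ternary_lex (t := a')) => [c|c a'c|].
  - by case: (_ \in _); case: (_ < _).
  - have -> : a < c by lia.
    have nb : c != b by rewrite -val_eqE /=; lia.
    have na' : c != a' by rewrite -val_eqE /=; lia.
    by rewrite !inE (negPf nb) (negPf na') a'c.
  have nb : a' != b by rewrite -val_eqE /=; lia.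
  rewrite !inE nb /= in a'I.
  by rewrite !inE eqxx (negPf a'I) ltnn.
(* Symmetrically, fewer than j elements of J lie below b here, so the rank of b in
   the complement of J \ b exceeds the rank b - j of a'. *)
have {}ba : b < a by rewrite ltn_neqAle ba andbT.
have a'b : a' < b.
  rewrite ltnNge; apply/negP => ba'.
  have := leq_nbelow (~: (J :\ b)) ba'; rewrite e.
  have := nbelowC b (J :\ b); have := ltn_nbelow bJ ba.
  by rewrite (nbelowD1 b bJ) ltnn; lia.
apply: (ternary_lex (t := a)) => [c|c ac|].
- by case: (_ \in _); case: (_ < _).
- have -> : a' < c by lia.
  have nb : c != b by rewrite -val_eqE /=; lia.
  have na' : c != a' by rewrite -val_eqE /=; lia.
  by rewrite !inE (negPf nb) (negPf na') ac.
have a'a : a' < a by lia.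
by rewrite !inE (eq_sym a b) nba aJ orbT ltnn a'a.
Qed.

End Nbelow.

(** Induction along the weight. The predicate [P I n] stands for the vanishing of
the unknown (I, n), and the hypothesis solves the equation (J, j) for its matched
unknown (J \ a, a - j). *)
Lemma subset_descent p (P : {set 'I_(2 * p + 1)} -> nat -> Prop) :
  (forall (J : {set 'I_(2 * p + 1)}) a, #|J| = p.+1 -> a \in J ->
     (forall b, b \in J -> b != a -> (nbelow a J <= b <= nbelow a J + p)%N ->
        P (J :\ b) (b - nbelow a J)%N) ->
     P (J :\ a) (a - nbelow a J)%N) ->
  forall (I : {set 'I_(2 * p + 1)}) k, #|I| = p -> (k <= p)%N -> P I k.
Proof.
move=> step.
(* The induction runs over marked subsets; the element of rank k in the complement
   of I gives the one matched with (I, k). *)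
suff H n (J : {set 'I_(2 * p + 1)}) a : #|J| = p.+1 -> a \in J ->
    (3 ^ (2 * p + 1) - marked_weight J a <= n)%N ->
    P (J :\ a) (a - nbelow a J)%N.
  move=> I k cI kp; have cC : #|~: I| = p.+1.
    by have := cardsC I; rewrite card_ord cI; lia.
  have [|a aC ak] := @nbelow_nth _ (~: I) k; first by rewrite cC.
  have aI : a \notin I by rewrite -in_setC.
  have := H _ (a |: I) a _ _ (leqnn _).
  rewrite setU1K // cardsU1 aI cI setU11 nbelowU // ltnn add0n => /(_ _ _).
  have := nbelowC a I; rewrite ak => E.
  have -> : (a - nbelow a I)%N = k by lia.
  by apply.
elim: n J a => [|n IH] J a cJ aJ; first by have := marked_weight_lt J a; lia.
move=> Jn; apply: (step J a) => // b bJ nba /andP[jb bp].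
have cI : #|J :\ b| = p by have := cardsD1 b J; rewrite bJ cJ; lia.
have cC : #|~: (J :\ b)| = p.+1.
  by have := cardsC (J :\ b); rewrite card_ord cI; lia.
have [|a' a'C a'k] := @nbelow_nth _ (~: (J :\ b)) (b - nbelow a J)%N.
  by rewrite cC; lia.
have a'I : a' \notin J :\ b by rewrite -in_setC.
have lt := marked_weight_step aJ bJ nba a'I jb a'k.
have := IH (a' |: (J :\ b)) a'.
rewrite setU1K // cardsU1 a'I cI setU11 nbelowU // ltnn add0n => /(_ erefl erefl).
have := nbelowC a' (J :\ b); rewrite a'k => E.
have -> : (a' - nbelow a' (J :\ b))%N = (b - nbelow a J)%N by lia.
apply; rewrite -ltnS; apply: leq_trans Jn.
exact: ltn_sub2l (marked_weight_lt J a) lt.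
Qed.

(** * The equations in coordinates *)

Section Coordinates.
Variables (K : fieldType) (m k : nat).
Implicit Types (w : extpow K m k) (I : {set 'I_m}).

(** Extending the coordinates by zero to all subsets avoids carrying the
cardinality proof when an element is removed from a subset. *)
Definition ext_coord w I : K := if insub I is Some A then w A else 0.

Lemma ext_coordE w (A : ksubset m k) : ext_coord w (val A) = w A.
Proof. by rewrite /ext_coord valK. Qed.

Lemma wedge_basis_coord i w (B : ksubset m k.+1) :
  wedge_basis K k i w B =
    if i \in val B then
      (-1) ^+ nbelow i (val B :\ i) * ext_coord w (val B :\ i) else 0.
Proof.
rewrite lfunE /= ffunE (bigD1 i) //= [X in _ + X]big1 ?addr0 => [|j nji].
  case: ifP => iB.
    have H : #|val B :\ i| == k.
      by have := valP B; rewrite /= (cardsD1 i) iB add1n eqSS.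
    pose A : ksubset m k := Sub (val B :\ i) H.
    rewrite (big_pred1 A) => [|C].
      by rewrite mxE !eqxx mulr1 -(ext_coordE w A).
    rewrite /= -[C == A]val_eqE /=; apply/andP/eqP => [[iC /eqP->]|->].
      by rewrite setU1K.
    by rewrite !inE eqxx setD1K.
  rewrite big1 // => C /andP[_ /eqP BE].
  by rewrite BE setU11 in iB.
by rewrite big1 // => C _; rewrite mxE (negPf nji) mulr0 mul0r.
Qed.

End Coordinates.

(** The hypothesis is the system L w = 0, equation j being the sum of the
e_i /\ w_k with i + k = p + j. The descent applies with n = p - k, in terms of
which i = j + n. *)
Lemma hankel_wedge_inj (K : fieldType) (p : nat)
    (w : 'I_p.+1 -> extpow K (2 * p + 1) p) :
  (forall j : 'I_p.+1, \sum_(i < 2 * p + 1) \sum_(k < p.+1)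
     (i + k == p + j)%N%:R *: wedge_basis K p i (w k) = 0) ->
  forall k, w k = 0.
Proof.
move=> w0.
suff H (I : {set 'I_(2 * p + 1)}) n : #|I| = p -> (n <= p)%N ->
    forall k : 'I_p.+1, (n + k = p)%N -> ext_coord (w k) I = 0.
  move=> k; apply/ffunP => A; rewrite -ext_coordE [RHS]ffunE.
  have kp : (k <= p)%N by rewrite -ltnS.
  by apply: (H _ (p - k)%N); [exact/eqP/(valP A) | lia | lia].
apply: (subset_descent (P := fun I n =>
  forall k : 'I_p.+1, (n + k = p)%N -> ext_coord (w k) I = 0)) => J a cJ aJ IH k ak.
have jp : (nbelow a J < p.+1)%N.
  rewrite -cJ; apply/proper_card/properP; split.
    by apply/subsetP => c; rewrite inE => /andP[].
  by exists a => //; rewrite inE ltnn andbF.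
have ja : (nbelow a J <= a)%N by have := nbelowC a J; lia.
have HJ : #|J| == p.+1 by apply/eqP.
have /ffunP/(_ (Sub J HJ)) := w0 (Ordinal jp).
rewrite sum_ffunE [RHS]ffunE (bigD1 a) //= [X in _ + X]big1 ?addr0 => [|b nba].
  rewrite sum_ffunE (bigD1 k) //= [X in _ + X]big1 ?addr0 => [|k' nk].
    have -> : (a + k == p + nbelow a J)%N by lia.
    rewrite scale1r wedge_basis_coord /= aJ => /eqP.
    by rewrite mulf_eq0 signr_eq0 => /eqP.
  rewrite (_ : (_ == _) = false) ?scale0r ?ffunE //.
  by apply/negP => /eqP E; case/negP: nk; apply/eqP/val_inj => /=; lia.
rewrite sum_ffunE big1 // => k' _; rewrite ffunE wedge_basis_coord /=.
case: ifP => bJ; last by rewrite scaler0.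
case: eqP => [E|_]; last by rewrite scale0r.
have kp : (k' <= p)%N by rewrite -ltnS.
rewrite (IH b bJ nba) ?mulr0 ?scaler0 //; lia.
Qed.

Lemma shift_mxE (K : fieldType) p i (j k : 'I_p.+1) :
  shift_mx K p i.+1 j k = (i + k == p + j)%N%:R.
Proof. by rewrite mxE; congr (nat_of_bool _)%:R; apply/eqP/eqP; lia. Qed.

(** * Reading the tensor product as a tuple of exterior vectors *)

Section TensorCoordinates.
Variable K : fieldType.

Definition cV_coord n (k : 'I_n) : dual 'cV[K]_n :=
  linfun (fun v : 'cV[K]_n => v k ord0 : K^o).

Lemma cV_coordE n (k : 'I_n) v : cV_coord k v = v k ord0.
Proof.
have l : linear (fun v : 'cV[K]_n => v k ord0 : K^o).
  by move=> a x y; rewrite !mxE.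
pose f : {linear 'cV[K]_n -> K^o} :=
  HB.pack (fun v : 'cV[K]_n => v k ord0 : K^o) (GRing.isLinear.Build _ _ _ _ _ l).
exact: (lfunE f).
Qed.

Lemma dual_coord_sum n (phi : dual 'cV[K]_n) :
  phi = \sum_k phi (basis_vec K k) *: cV_coord k.
Proof.
apply/lfunP => v; rewrite {1}(col_basis v) linear_sum sum_lfunE.
apply: eq_bigr => k _; rewrite linearZ scale_lfunE cV_coordE; exact: mulrC.
Qed.

Lemma dual_map_coord n (A : 'M[K]_n) (j : 'I_n) :
  dual_map (mx_endo A) (cV_coord j) = \sum_k A j k *: cV_coord k.
Proof.
rewrite lfunE /= /dual_map_fun [LHS]dual_coord_sum; apply: eq_bigr => k _.
congr (_ *: _); rewrite comp_lfunE cV_coordE lfunE mxE (bigD1 k) //=.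
rewrite mxE !eqxx mulr1 big1 ?addr0 // => l nlk.
by rewrite mxE (negPf nlk) mulr0.
Qed.

Lemma tensor_coord_eq0 (U : vectType K) n (X : tensor U 'cV[K]_n) :
  (forall k, X (cV_coord k) = 0) -> X = 0.
Proof.
move=> X0; apply/lfunP => phi; rewrite [phi]dual_coord_sum !linear_sum.
by apply: eq_bigr => k _; rewrite !linearZ /= X0 zero_lfunE.
Qed.

Lemma tensor_map_apply (U V U' V' : vectType K) (f : 'Hom(U, U'))
    (g : 'Hom(V, V')) (X : tensor U V) (phi : dual V') :
  tensor_map f g X phi = f (X (dual_map g phi)).
Proof.
have -> : tensor_map f g X = tensor_map_fun f g X by exact: lfunE.
by rewrite !comp_lfunE.
Qed.

Lemma tensor_map_coord (U U' : vectType K) n (f : 'Hom(U, U')) (A : 'M[K]_n)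
    (X : tensor U 'cV[K]_n) (j : 'I_n) :
  tensor_map f (mx_endo A) X (cV_coord j) = \sum_k A j k *: f (X (cV_coord k)).
Proof.
rewrite tensor_map_apply dual_map_coord (linear_sum X) (linear_sum f).
by apply: eq_bigr => k _; rewrite (linearZ_LR X) (linearZ_LR f).
Qed.

End TensorCoordinates.

(** * Dimension count and conclusion *)

Lemma dim_tensor_extpow (K : fieldType) m k n :
  \dim {: tensor (extpow K m k) 'cV[K]_n} = (n * 'C(m, k))%N.
Proof.
have -> : 'C(m, k) = #|{: ksubset m k}|.
  rewrite card_sig -[in LHS](card_ord m) -card_draws.
  by apply: eq_card => A; rewrite !inE.
(* The dimension of each space of linear maps, column vectors or finite functions
   computes to a product; the factors 1 come from K^o and from the single column. *)
rewrite dimvf -[LHS]/((n * 1) * 1 * (#|{: ksubset m k}| * 1))%N.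
by rewrite !muln1.
Qed.

(* The index i : 'I_(2 * p + 1) stands for i + 1 in 1, ..., 2 * p + 1. *)
Theorem proposition1p8 (K : fieldType) (p : nat) :
  let m := (2 * p + 1)%N in
  let L : 'Hom(tensor (extpow K m p) 'cV[K]_p.+1,
               tensor (extpow K m p.+1) 'cV[K]_p.+1) :=
    \sum_(i < m) tensor_map (wedge_basis K p i) (mx_endo (shift_mx K p i.+1)) in
  bijective L.
Proof.
move=> m L.
have kL : lker L == 0%VS.
  rewrite -subv0; apply/subvP => X; rewrite memv_ker memv0 => /eqP LX.
  apply/eqP/tensor_coord_eq0; apply: hankel_wedge_inj => j.
  have := congr1 (fun Y : tensor _ _ => Y (cV_coord K j)) LX.
  rewrite zero_lfunE => E0; rewrite -[RHS]E0 sum_lfunE sum_lfunE.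
  apply: eq_bigr => i _; rewrite tensor_map_coord; apply: eq_bigr => k _.
  by rewrite shift_mxE.
have fL : limg L = fullv.
  apply/eqP; rewrite eqEdim subvf limg_dim_eq; last first.
    by rewrite (eqP kL) capv0.
  have eC : 'C(m, p.+1) = 'C(m, p).
    by rewrite -(@bin_sub m p) /m; [congr 'C(_, _); lia | lia].
  rewrite (dim_tensor_extpow K m p p.+1) (dim_tensor_extpow K m p.+1 p.+1).
  by rewrite eC leqnn.
exists (L^-1)%VF => X; first by rewrite lker0_lfunK.
by rewrite limg_lfunVK // fL memvf.
Qed.
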